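(* Fix an output index $i$ and $\bar p\in\mathbb{N}$, and let $\theta_{i_1}\in\mathbb{R}^{o(m+1)}$ be any parameter vector such that $h_{p,o}(\theta_{i_1})\in\Gamma_{i_p}$ for all $p\in[2,\bar p]$. Set $\theta_{i_p}=h_{p,o}(\theta_{i_1})$ and $\chi_{i,\bar p}=o\hat L_i\hat\rho_i^{\bar p+1}$, and define $$\hat\tau_{i_\infty}(\theta_{i_{\bar p}})\doteq\hat\tau_{i_{\bar p}}(\theta_{i_{\bar p}})\left(\frac{1}{1-\chi_{i,\bar p}}\right)+\bar d_i\left(\frac{\chi_{i,\bar p}}{1-\chi_{i,\bar p}}\right).$$ Then $$\hat\tau_{i_p}\xrightarrow{p\to\infty}\hat\tau_{i_\infty}\iff o\hat L_i\hat\rho_i^{\bar p+1}<1,$$ where $\hat\tau_{i_p}$ for $p>\bar p$ is the iterative simulation error bound defined in the context.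
   Context: Setting: an LTI system $x(k+1)=Ax(k)+Bu(k)$, $z(k)=Cx(k)$ with $x(k)\in\mathbb{R}^n$, $u(k)\in\mathbb{R}^m$, $z(k)\in\mathbb{R}^q$ and noisy measurements $y(k)=z(k)+d(k)$, $|d_i(k)|\le\bar d_{0_i}$; subscript $i$ denotes the $i$-th component. $\bar d_i$ is an estimate of $\bar d_{0_i}$ and $o\in\mathbb{N}$ is the model order. Model: the one-step-ahead ARX model is $\hat z_i(k+1)=\varphi_{i_1}(k)^T\theta_{i_1}$, where, for a horizon $p$, $\varphi_{i_p}(k)=[y_i(k),\dots,y_i(k-o+1),\,u(k+p-1)^T,\dots,u(k)^T,\dots,u(k-o+1)^T]^T\in\mathbb{R}^{o+m(o+p-1)}$. Iterating the one-step-ahead model $p$ times (predicted outputs replacing future measured ones) gives $\hat z_i(k+p)=\varphi_{i_p}(k)^T\theta_{i_p}$ with $\theta_{i_p}=h_{p,o}(\theta_{i_1})$, which defines the polynomial map $h_{p,o}:\mathbb{R}^{o(m+1)}\to\mathbb{R}^{o+m(o+p-1)}$. Write $\theta_{i_p}=[\theta_{i_{p,z}}^T,\theta_{i_{p,u}}^T]^T$, with $\theta_{i_{p,z}}\in\mathbb{R}^o$ the output coefficients and $\theta_{i_{p,u}}\in\mathbb{R}^{m(o+p-1)}$ the input coefficients; $^{(l)}$ denotes the $l$-th entry. Data: for each $p$, $\tilde{\mathscr{V}}_{i_p}^N$ is a finite set of $N$ measured pairs $(\tilde\varphi_{i_p}(k),\tilde y_{i_p}(k))$, $k=1,\dots,N$,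 with $\tilde y_{i_p}(k)=\tilde y_i(k+p)$. Let $\underline\lambda_{i_p}$ be the minimum of $\lambda\ge0$ over $\lambda$ and $\theta_{i_p}\in\Omega_p$ subject to $|\tilde y_{i_p}-\tilde\varphi_{i_p}^T\theta_{i_p}|\le\lambda+\bar d_i$ for all data in $\tilde{\mathscr{V}}_{i_p}^N$, where $\Omega_p$ is a (very large) compact approximation of $\mathbb{R}^{o+m(o+p-1)}$. Let $\hat{\bar\varepsilon}_{i_p}=\alpha\underline\lambda_{i_p}$ with a fixed $\alpha>1$. Decay estimates: $\hat L_i>0$ and $\hat\rho_i\in(0,1)$ are estimated decay parameters, obtained as follows: for a horizon $\bar p_i$, $(L_i',\hat\rho_i)$ minimizes $\sum_{p=1}^{\bar p_i}(\underline\lambda_{i_p}-L_i'\hat\rho_i^{p+1})^2$ subject to $L_i'\hat\rho_i^{p+1}\ge\underline\lambda_{i_p}$ for $p=1,\dots,\bar p_i$, $L_i'>0$, $0<\hat\rho_i<1$; and $\hat L_i=L_i'/(o\bar d_i)$. Here $\bar p_i$ is the smallest horizon such that $\underline\lambda_{i_p}<\delta$ for all $p\ge\bar p_i$, with $\delta\approx0$ a tolerance. Sets: $\Theta_{i_p}=\{\theta:\ |\tilde y_{i_p}-\tilde\varphi_{i_p}^T\theta|\le\hat{\bar\varepsilon}_{i_p}+\bar d_i\ \text{for all data in }\tilde{\mathscr{V}}_{i_p}^N\}$; $\Gamma_{i_p}=\{\theta_{i_p}:\ |\theta_{i_{p,z}}^{(l)}|\le\hat L_i\hat\rho_i^{p+l},\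 l\in[1,o],\ \text{and}\ |\theta_{i_{p,u}}^{(l)}|\le\hat L_i\hat\rho_i^{\lceil l/m\rceil},\ l\in[1,m(o+p-1)]\}$; and $\Theta_{i_p}^{L\rho}=\Theta_{i_p}\cap\Gamma_{i_p}$ (Feasible Parameter Set). Simulation error bounds: for $p\in[1,\bar p]$, $$\hat\tau_{i_p}(\theta_{i_p})=\gamma\Big(\max_{\tilde\varphi_{i_p}\in\tilde{\mathscr{V}}_{i_p}^N}\ \max_{\theta\in\Theta_{i_p}^{L\rho}}|\tilde\varphi_{i_p}^T(\theta-\theta_{i_p})|\Big)+\hat{\bar\varepsilon}_{i_p},\qquad \gamma>1\text{ fixed}.$$ For $p>\bar p$, written $p=\ell\bar p+j$ with $\ell\ge1$, $j\in[1,\bar p)$ integers, $\hat\tau_{i_p}$ denotes the iterative over-estimate $$\hat\tau_{i_{\ell\bar p+j}}(\theta_{i_{\ell\bar p+j}})=\hat\tau_{i_{\bar p}}(\theta_{i_{\bar p}})\big(1+\chi_{i,\bar p}+\dots+\chi_{i,\bar p}^{\ell-1}\big)+\bar d_i\big(\chi_{i,\bar p}+\dots+\chi_{i,\bar p}^{\ell}\big)+\tau_{i_{\max\{j,\ell o\}}}\,\chi_{i,\bar p}^{\ell},$$ where $\tau_{i_{\max\{j,\ell o\}}}=\max\{\hat\tau_{i_{j-\ell o}}(\theta_{i_{j-\ell o}}),\dots,\hat\tau_{i_j}(\theta_{i_j})\}$, with only positive horizon indices considered in the maximum.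
   Formalization: In the decomposition p = ℓp̄ + j the formal statement lets j range over [1, p̄] instead of [1, p̄), since otherwise the iterative bound is undefined at multiples of p̄ (and at all p > p̄ when p̄ = 1) and the limit p→∞ would not make sense. *)

(* Defs.v *)
From HB Require Import structures.
From mathcomp Require Import all_boot all_order all_algebra.
From mathcomp Require Import all_classical all_reals all_analysis.
From mathcomp Require Import zify.

Set Implicit Arguments.
Unset Strict Implicit.
Unset Printing Implicit Defensive.

Import Order.TTheory GRing.Theory Num.Theory.
Import numFieldNormedType.Exports.
Local Open Scope classical_set_scope.
Local Open Scope ring_scope.

(* R^(o + m(o+p-1)): [o] output coefficients (block [usubmx]) followed by
   [m(o+p-1)] input coefficients (block [dsubmx]). *)
Notation param R o m p := ('cV[R]_(o + m * (o + p - 1))).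

Definition dot (R : realType) (n : nat) (a b : 'cV[R]_n) : R := (a^T *m b) 0 0.

Lemma input_comp_subproof (m K : nat) (l : 'I_(m * K)) : (l %% m < m)%N.
Proof. by rewrite ltn_mod; case: m l => [[]|]. Qed.

(* A stack of [K] vectors of R^m: entry [l] (from 0) is component [l %% m] of
   vector number [l %/ m]. *)
Definition input_comp (m K : nat) (l : 'I_(m * K)) : 'I_m :=
  Ordinal (input_comp_subproof l).

(* phi_p(k) = [y(k), ..., y(k-o+1), u(k+p-1)^T, ..., u(k-o+1)^T]^T *)
Definition regressor (R : realType) (o m p : nat)
    (y : int -> R) (u : int -> 'cV[R]_m) (k : int) : param R o m p :=
  col_mx (\col_(r < o) y (k - r%:Z))
         (\col_(l < m * (o + p - 1))
            u (k + p%:Z - 1 - (l %/ m)%N%:Z) (input_comp l) 0).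

(* The output signal in which y(k+1), ..., y(k+p) are replaced by the successive
   one-step-ahead predictions, each computed from the previous ones. *)
Fixpoint predicted (R : realType) (o m : nat) (theta1 : param R o m 1)
    (y : int -> R) (u : int -> 'cV[R]_m) (k : int) (p : nat) : int -> R :=
  if p is p'.+1 then
    let w := predicted theta1 y u k p' in
    fun t => if t == k + p%:Z then dot (regressor o 1 w u (k + p'%:Z)) theta1
             else w t
  else y.

(* zhat(k+p) *)
Definition prediction (R : realType) (o m : nat) (theta1 : param R o m 1)
    (y : int -> R) (u : int -> 'cV[R]_m) (k : int) (p : nat) : R :=
  predicted theta1 y u k p (k + p%:Z).

(* Signals whose regressor of horizon [p] at time 0 is [v]; see [signalsK]. *)
Definition output_signal (R : realType) (o m p : nat) (v : param R o m p)
    (t : int) : R :=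
  \sum_(r < o | t == - r%:Z) usubmx v r 0.

Definition input_signal (R : realType) (o m p : nat) (v : param R o m p)
    (t : int) : 'cV[R]_m :=
  \col_c \sum_(l < m * (o + p - 1) |
           (t == p%:Z - 1 - (l %/ m)%N%:Z) && (input_comp l == c)) dsubmx v l 0.

(* The p-step prediction is linear in the regressor; the l-th entry of
   h_{p,o}(theta_1) is its value at the l-th canonical regressor.  Lemmas
   [predictionE] and [h_unique] state that [h] is the map defined by
   zhat(k+p) = phi_p(k)^T h_{p,o}(theta_1). *)
Definition h (R : realType) (o m p : nat) (theta1 : param R o m 1) :
    param R o m p :=
  \col_l prediction theta1 (output_signal (delta_mx l 0 : param R o m p))
                           (input_signal (delta_mx l 0 : param R o m p)) 0 p.

Section HSpec.
Context (R : realType) (o m : nat).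
Implicit Types (theta : param R o m 1) (y : int -> R) (u : int -> 'cV[R]_m).

Lemma dotE n (a b : 'cV[R]_n) : dot a b = \sum_l a l 0 * b l 0.
Proof. by rewrite /dot mxE; apply: eq_bigr => l _; rewrite mxE. Qed.

Lemma signalsK p (v : param R o m p) : (0 < p)%N ->
  regressor o p (output_signal v) (input_signal v) 0 = v.
Proof.
move=> p0; rewrite -[RHS]vsubmxK; congr col_mx; apply/colP => l; rewrite mxE.
  rewrite /output_signal (bigD1 l) /=; last by rewrite sub0r.
  rewrite big1 ?addr0 // => r /andP[/eqP E /eqP]; case; apply/val_inj => /=; lia.
rewrite mxE (bigD1 l) /=; last by rewrite add0r !eqxx.
rewrite big1 ?addr0 // => r /andP[/andP[/eqP E /eqP[F]] /eqP]; case.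
apply/val_inj => /=; rewrite (divn_eq r m) (divn_eq l m) F.
by congr (_ * _ + _)%N; lia.
Qed.

Lemma predicted_local theta1 y u k y' u' k' p :
  regressor o p y u k = regressor o p y' u' k' ->
  forall q, (q <= p)%N -> forall a : int, - o%:Z < a -> a <= q%:Z ->
  predicted theta1 y u k q (k + a) = predicted theta1 y' u' k' q (k' + a).
Proof.
move=> /eq_col_mx[/colP Ey /colP Eu]; elim=> [|q IH] qp a oa aq /=.
  have ao : (`|a| < o)%N by lia.
  have := Ey (Ordinal ao); rewrite !mxE /=.
  have E (t : int) : t + a = t - `|a|%N%:Z by lia.
  by rewrite !E.
rewrite !(inj_eq (addrI _)); case: eqP => [_|aq']; last by apply: IH; lia.
congr dot; congr col_mx; apply/colP => l; rewrite !mxE.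
  by rewrite -!addrA; apply: IH; have := ltn_ord l; lia.
have lm : (l %/ m < o)%N.
  have := ltn_ord l; move: (nat_of_ord l) => {}l; rewrite addnK mulnC => lo.
  by rewrite ltn_divLR //; lia.
have m0 : (0 < m)%N by have := ltn_ord (input_comp l); lia.
have cm := ltn_ord (input_comp l).
have bnd : ((p - q.+1 + l %/ m) * m + l %% m < m * (o + p - 1))%N.
  have : ((p - q.+1 + l %/ m).+1 <= o + p - 1)%N by lia.
  by rewrite -(leq_pmul2l m0); move: cm => /=; nia.
have := Eu (Ordinal bnd); rewrite !mxE /= divnMDl // (divn_small cm) addn0.
have -> : input_comp (Ordinal bnd) = input_comp l.
  by apply/val_inj; rewrite /= modnMDl modn_mod.
have E (z : int) : z + p%:Z - 1 - (p - q.+1 + l %/ m)%N%:Z =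
            z + q%:Z + 1 - 1 - (l %/ m)%N%:Z by lia.
by rewrite !E.
Qed.

Lemma predicted_linear theta1 k p (I : finType) (c : I -> R)
    (Y : I -> int -> R) (U : I -> int -> 'cV[R]_m) t :
  predicted theta1 (fun s => \sum_i c i * Y i s)
                   (fun s => \sum_i c i *: U i s) k p t =
  \sum_i c i * predicted theta1 (Y i) (U i) k p t.
Proof.
elim: p t => //= p IH t; case: eqP => // _.
under [RHS]eq_bigr do rewrite dotE mulr_sumr.
rewrite exchange_big dotE; apply: eq_bigr => l _.
under eq_bigr do rewrite mulrA.
rewrite -mulr_suml; congr (_ * _).
case: (split_ordP l) => j ->.
  rewrite col_mxEu mxE IH; apply: eq_bigr => i _; by rewrite col_mxEu mxE.
rewrite col_mxEd mxE summxE; apply: eq_bigr => i _.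
by rewrite col_mxEd !mxE.
Qed.

Lemma output_signalE p (v : param R o m p) t :
  output_signal v t =
  \sum_l v l 0 * output_signal (delta_mx l 0 : param R o m p) t.
Proof.
rewrite /output_signal; under [RHS]eq_bigr do rewrite mulr_sumr.
rewrite exchange_big; apply: eq_bigr => r _.
rewrite mxE (bigD1 (lshift _ r)) //= !mxE !eqxx mulr1 big1 ?addr0 // => l lr.
by rewrite !mxE eq_sym (negbTE lr) mulr0.
Qed.

Lemma input_signalE p (v : param R o m p) t :
  input_signal v t =
  \sum_l v l 0 *: input_signal (delta_mx l 0 : param R o m p) t.
Proof.
apply/colP => c; rewrite summxE mxE.
under [RHS]eq_bigr do rewrite !mxE mulr_sumr.
rewrite exchange_big; apply: eq_bigr => r _.
rewrite mxE (bigD1 (rshift _ r)) //= !mxE !eqxx mulr1 big1 ?addr0 // => l lr.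
by rewrite !mxE eq_sym (negbTE lr) mulr0.
Qed.

Lemma predictionE theta1 y u k p : (0 < p)%N ->
  prediction theta1 y u k p = dot (regressor o p y u k) (h p theta1).
Proof.
move=> p0; set v := regressor o p y u k.
have vE : v = regressor o p (output_signal v) (input_signal v) 0.
  by rewrite signalsK.
have pa : - o%:Z < p%:Z by lia.
rewrite /prediction (predicted_local theta1 vE (leqnn p) pa (lexx _)).
have -> : output_signal v =
    fun s => \sum_l v l 0 * output_signal (delta_mx l 0 : param R o m p) s.
  by apply/funext => s; exact: output_signalE.
have -> : input_signal v =
    fun s => \sum_l v l 0 *: input_signal (delta_mx l 0 : param R o m p) s.
  by apply/funext => s; exact: input_signalE.
rewrite predicted_linear dotE; apply: eq_bigr => l _.
by rewrite [h p theta1 l 0]mxE.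
Qed.

Lemma h_unique theta1 p (theta : param R o m p) : (0 < p)%N ->
  (forall y u k, prediction theta1 y u k p = dot (regressor o p y u k) theta) ->
  theta = h p theta1.
Proof.
move=> p0 H; apply/colP => l; rewrite mxE H signalsK // dotE.
rewrite (bigD1 l) //= mxE !eqxx mul1r big1 ?addr0 // => j jl.
by rewrite mxE (negbTE jl) mul0r.
Qed.

Lemma h1 theta1 : h 1 theta1 = theta1.
Proof.
by apply/esym/h_unique => // y u k; rewrite /prediction /= eqxx addr0.
Qed.

End HSpec.

(* Time 2 - o is that of the oldest sample occurring in phi_p(1). *)
Definition trajectory (R : realType) (n m q o : nat)
    (A : 'M[R]_n) (B : 'M[R]_(n, m)) (C : 'M[R]_(q, n))
    (x : int -> 'cV[R]_n) (u : int -> 'cV[R]_m)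
    (z d y : int -> 'cV[R]_q) (dbar0 : 'I_q -> R) : Prop :=
  forall k : int, 2 - o%:Z <= k ->
    [/\ x (k + 1) = A *m x k + B *m u k,
        z k = C *m x k,
        y k = z k + d k &
        forall j, `|d k j 0| <= dbar0 j].

(* The data are the pairs (phi_p(k), y(k+p)) with k = 1, ..., N. *)
Definition data_regressor (R : realType) (o m N p : nat) (y : int -> R)
    (u : int -> 'cV[R]_m) (k : 'I_N) : param R o m p :=
  regressor o p y u k.+1%:Z.

Definition data_output (R : realType) (N p : nat) (y : int -> R) (k : 'I_N) : R :=
  y (k.+1%:Z + p%:Z).

Definition consistent (R : realType) (o m N p : nat) (y : int -> R)
    (u : int -> 'cV[R]_m) (b : R) : set (param R o m p) :=
  [set theta | forall k : 'I_N,
     `|data_output p y k - dot (data_regressor o p y u k) theta| <= b].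

Definition is_minimum (R : realType) (S : set R) (a : R) : Prop :=
  S a /\ lbound S a.

Definition is_lambda (R : realType) (o m N p : nat) (y : int -> R)
    (u : int -> 'cV[R]_m) (dbar : R) (Omega : set (param R o m p)) (a : R) : Prop :=
  is_minimum [set lam | 0 <= lam /\
    exists2 theta, Omega theta & consistent N y u (lam + dbar) theta] a.

Definition is_decay_horizon (R : realType) (lambda : nat -> R) (delta : R)
    (P : nat) : Prop :=
  [/\ (0 < P)%N,
      forall p, (P <= p)%N -> lambda p < delta &
      forall P', (0 < P')%N -> (forall p, (P' <= p)%N -> lambda p < delta) ->
        (P <= P')%N].

Definition decay_admissible (R : realType) (lambda : nat -> R) (P : nat)
    (L rho : R) : Prop :=
  [/\ 0 < L, 0 < rho, rho < 1 &
      forall p, (1 <= p <= P)%N -> lambda p <= L * rho ^+ p.+1].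

Definition decay_cost (R : realType) (lambda : nat -> R) (P : nat)
    (L rho : R) : R :=
  \sum_(1 <= p < P.+1) (lambda p - L * rho ^+ p.+1) ^+ 2.

Definition is_decay_fit (R : realType) (lambda : nat -> R) (P : nat)
    (L rho : R) : Prop :=
  decay_admissible lambda P L rho /\
  forall L' rho', decay_admissible lambda P L' rho' ->
    decay_cost lambda P L rho <= decay_cost lambda P L' rho'.

(* Entries are numbered from 0 here: the l-th output entry is number l - 1, and
   [(j %/ m).+1] is the ceiling of l / m for l = j + 1. *)
Definition Gamma (R : realType) (o m p : nat) (L rho : R) : set (param R o m p) :=
  [set theta |
    (forall j : 'I_o, `|usubmx theta j 0| <= L * rho ^+ (p + j.+1)) /\
    (forall j : 'I_(m * (o + p - 1)),
       `|dsubmx theta j 0| <= L * rho ^+ (j %/ m).+1)].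

Definition FPS (R : realType) (o m N p : nat) (y : int -> R)
    (u : int -> 'cV[R]_m) (eps dbar L rho : R) : set (param R o m p) :=
  consistent N y u (eps + dbar) `&` @Gamma R o m p L rho.

(* The inner maximum over the FPS, which is compact, is written as a supremum
   (0 in the degenerate case of an empty FPS);
   the seed 0 of the outer maximum is neutral on absolute values. *)
Definition tau_direct (R : realType) (o m N p : nat) (y : int -> R)
    (u : int -> 'cV[R]_m) (gamma eps dbar L rho : R) (theta_p : param R o m p) : R :=
  gamma * (\big[Num.max/0]_(k < N)
     sup [set `|dot (data_regressor o p y u k) (theta - theta_p)| |
          theta in FPS N y u eps dbar L rho]) + eps.

(* The error bound at every horizon, from its values [tau1] on [1, P].  For
   p > P, the decomposition p = l P + j is the one with 1 <= j <= P, so that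
   multiples of P are covered (see [tauE]).  The indices of the maximum are
   the positive ones among j - l o, ..., j. *)
Definition tau (R : realType) (o P : nat) (tau1 : nat -> R) (dbar chi : R)
    (p : nat) : R :=
  if (p <= P)%N then tau1 p else
  let l := (p.-1 %/ P)%N in
  let j := (p.-1 %% P).+1 in
  tau1 P * (\sum_(0 <= s < l) chi ^+ s) + dbar * (\sum_(1 <= s < l.+1) chi ^+ s)
  + (\big[Num.max/tau1 j]_(maxn 1 (j - l * o) <= r < j.+1) tau1 r) * chi ^+ l.

Lemma tauE (R : realType) (o P : nat) (tau1 : nat -> R) (dbar chi : R)
    (l j : nat) : (1 <= l)%N -> (1 <= j <= P)%N ->
  tau o P tau1 dbar chi (l * P + j) =
  tau1 P * (\sum_(0 <= s < l) chi ^+ s) + dbar * (\sum_(1 <= s < l.+1) chi ^+ s)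
  + (\big[Num.max/tau1 j]_(maxn 1 (j - l * o) <= r < j.+1) tau1 r) * chi ^+ l.
Proof.
case: j => // j l1 jP; rewrite /tau ifF; last by apply/negbTE; nia.
rewrite addnS /= modnMDl modn_small // divnMDl ?divn_small ?addn0 //; lia.
Qed.

Definition tau_infty (R : realType) (tauP dbar chi : R) : R :=
  tauP * (1 / (1 - chi)) + dbar * (chi / (1 - chi)).

(* Main.v *)
Require Import Defs.
From mathcomp Require Import all_boot all_order all_algebra.
From mathcomp Require Import all_classical all_reals all_analysis.
From mathcomp Require Import zify lra.
Import Order.TTheory GRing.Theory Num.Theory.
Import numFieldNormedType.Exports.
Local Open Scope classical_set_scope.
Local Open Scope ring_scope.

(** A horizon [p > pbar] enters the iterated bound through [l], the number of full
    blocks of length [pbar] that precede [p], and through a maximum of the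
    finitely many direct bounds [tau1 1], ..., [tau1 pbar], which therefore
    stays bounded.  Up to that bounded maximum multiplied by [chi ^+ l], the
    bound is [(tau1 pbar + dbar * chi) * (1 + chi + ... + chi ^+ (l - 1))].

    If [chi < 1], the geometric sum tends to [1 / (1 - chi)] and the remainder
    vanishes ([tau_cvg]).  If [1 <= chi], each block adds at least [dbar > 0]
    and no other contribution is negative, so the bound grows at least linearly
    in [l] ([tau_ge]) and has no finite limit ([tau_cvg_lt1]).

    Only three facts about the identification problem enter: [dbar] is
    positive, so is [chi], because the fitted decay parameters are, and the
    direct bounds are nonnegative, because each [lambda p] is a minimum over
    nonnegative numbers ([tau_direct_ge0]). *)

(** The noise terms start at [chi ^+ 1]; factoring out [chi] leaves the
    geometric sum of the [tau1 P] term, so a single limit suffices. *)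
Lemma sum_expr_shift (R : realType) (c : R) (l : nat) :
  \sum_(1 <= s < l.+1) c ^+ s = c * \sum_(0 <= s < l) c ^+ s.
Proof.
by rewrite big_add1 mulr_sumr; apply: eq_bigr => s _; rewrite exprS.
Qed.

Lemma cvg_sum_expr (R : realType) (c : R) : `|c| < 1 ->
  (\sum_(0 <= s < l) c ^+ s) @[l --> \oo] --> (1 - c)^-1.
Proof.
move=> c1; have := @cvg_geometric_series R 1 c c1; rewrite mul1r.
suff -> : (fun l => \sum_(0 <= s < l) c ^+ s) = series (geometric 1 c) by [].
by apply/funext => l; apply: eq_bigr => s _; rewrite /= mul1r.
Qed.

Lemma cvg_divn (P : nat) : (0 < P)%N -> (p.-1 %/ P)%N @[p --> \oo] --> \oo.
Proof.
move=> P0; apply/cvgnyPge => K; exists (K * P).+1 => // p /= Kp.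
by rewrite leq_divRL //; case: p Kp.
Qed.

Section ErrorBound.
Context (R : realType) (o P : nat) (tau1 : nat -> R) (dbar chi : R).
Hypothesis P_gt0 : (0 < P)%N.
Hypothesis tau1_ge0 : forall p, (1 <= p <= P)%N -> 0 <= tau1 p.

(** The window of the maximum moves with [l] and [j] but stays inside [1, P],
    so the sum of all the direct bounds, which are nonnegative, dominates every
    such maximum: a bound uniform in [l] and [j] is all that the limit needs. *)
Lemma window_max_bounds (l j : nat) : (1 <= j <= P)%N ->
  0 <= \big[Num.max/tau1 j]_(maxn 1 (j - l * o) <= r < j.+1) tau1 r
    <= \sum_(1 <= r < P.+1) tau1 r.
Proof.
move=> jP; have le_sum r : (1 <= r <= P)%N ->
    0 <= tau1 r <= \sum_(1 <= s < P.+1) tau1 s.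
  move=> rP; rewrite tau1_ge0 //= (bigD1_seq r) ?mem_index_iota ?iota_uniq //=.
  rewrite lerDl big_seq_cond sumr_ge0 // => s /andP[+ _].
  by rewrite mem_index_iota; apply: tau1_ge0.
rewrite big_nat_cond.
apply: (big_ind (fun a => 0 <= a <= \sum_(1 <= r < P.+1) tau1 r))
  => [|a b /andP[a0 ab] /andP[b0 bb]|r].
- exact: le_sum.
- by rewrite le_max a0 ge_max ab bb.
- by move=> /andP[rj _]; apply: le_sum; move: rj; rewrite geq_max; lia.
Qed.

Lemma tau_ge (l : nat) : 0 <= dbar -> 1 <= chi ->
  dbar * l.+1%:R <= tau o P tau1 dbar chi (l.+1 * P + 1).
Proof.
move=> d0 chi1; rewrite tauE //; have chi0 := le_trans ler01 chi1.
have sum_ge a b : (b - a)%N%:R <= \sum_(a <= s < b) chi ^+ s.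
  rewrite -[leLHS]sumr_const_nat; apply: ler_sum => s _; exact: exprn_ege1.
have sum_ge0 a b := le_trans (ler0n R _) (sum_ge a b).
have /andP[max0 _] : _ := @window_max_bounds l.+1 1 P_gt0.
rewrite -[leLHS]addr0 lerD //; last by rewrite mulr_ge0 // exprn_ge0.
rewrite -[leLHS]add0r lerD //.
  by rewrite mulr_ge0 //; apply: tau1_ge0; rewrite P_gt0 leqnn.
by rewrite ler_wpM2l //; have := sum_ge 1%N l.+2; rewrite subn1.
Qed.

Lemma tau_cvg_lt1 (a : R) : 0 < dbar ->
  tau o P tau1 dbar chi p @[p --> \oo] --> a -> chi < 1.
Proof.
move=> d0 cvg_tau; rewrite ltNge; apply/negP => chi1.
have /cvgrPdist_lt /(_ 1 ltr01) [K _ near_a] := cvg_tau.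
(* The Archimedean term makes [dbar * l.+1] exceed [a + 1]; adding [K] puts the
   horizon in the range where [tau] is within 1 of [a]. *)
pose l := (K + Num.bound (`|a + 1| / dbar)%R)%N.
have Kl : (K <= l.+1 * P + 1)%N by rewrite /l; nia.
have al : a + 1 < dbar * l.+1%:R.
  rewrite (le_lt_trans (ler_norm _)) // mulrC -ltr_pdivrMr //.
  have /archi_boundP/lt_le_trans : 0 <= `|a + 1| / dbar.
    by rewrite divr_ge0 // ltW.
  by apply; rewrite ler_nat /l; lia.
have := near_a _ Kl; rewrite /= ltr_norml => /andP[+ _].
have := tau_ge l (ltW d0) chi1; lra.
Qed.

Lemma tau_cvg : 0 <= chi -> chi < 1 ->
  tau o P tau1 dbar chi p @[p --> \oo] --> tau_infty (tau1 P) dbar chi.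
Proof.
move=> chi0 chi1; have chiN : `|chi| < 1 by rewrite ger0_norm.
pose l p := (p.-1 %/ P)%N; pose j p := (p.-1 %% P).+1.
pose rem p := (\big[Num.max/tau1 (j p)]_(maxn 1 (j p - l p * o) <= r < (j p).+1)
                 tau1 r) * chi ^+ l p.
have sum_cvg : (\sum_(0 <= s < l p) chi ^+ s) @[p --> \oo] --> (1 - chi)^-1.
  exact: cvg_comp _ _ (cvg_divn _ P_gt0) (cvg_sum_expr _ _ chiN).
have rem_cvg : rem p @[p --> \oo] --> 0.
  have chil : chi ^+ l p @[p --> \oo] --> 0.
    exact: cvg_comp _ _ (cvg_divn _ P_gt0) (cvg_expr chiN).
  apply: (@squeeze_cvgr _ _ _ _ (fun=> 0)
            (fun p => (\sum_(1 <= r < P.+1) tau1 r) * chi ^+ l p)).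
  - near=> p; have /(window_max_bounds (l p)) : (1 <= j p <= P)%N.
      by rewrite /j /= ltn_pmod.
    by case/andP=> max0 max_le; rewrite mulr_ge0 ?ler_wpM2r ?exprn_ge0.
  - exact: cvg_cst.
  - by rewrite -[X in _ --> X](mulr0 (\sum_(1 <= r < P.+1) tau1 r));
      apply: cvgMl_tmp.
rewrite /tau_infty div1r -[X in _ --> X]addr0.
pose main p := tau1 P * (\sum_(0 <= s < l p) chi ^+ s)
  + dbar * (chi * \sum_(0 <= s < l p) chi ^+ s).
have tauE : {near \oo, main \+ rem =1 tau o P tau1 dbar chi}.
  near=> p; have Pp : (P < p)%N by near: p; exact: nbhs_infty_gt.
  by rewrite /tau leqNgt Pp /= sum_expr_shift.
apply: cvg_trans (near_eq_cvg tauE) _; apply: cvgD rem_cvg.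
by apply: cvgD; do ?apply: cvgMl_tmp.
Unshelve. all: by end_near. Qed.

End ErrorBound.

Lemma tau_direct_ge0 (R : realType) (o m N p : nat) (y : int -> R)
    (u : int -> 'cV[R]_m) (gamma eps dbar L rho : R) (theta : param R o m p) :
  0 <= gamma -> 0 <= eps ->
  0 <= tau_direct N y u gamma eps dbar L rho theta.
Proof.
move=> gamma0 eps0; rewrite /tau_direct addr_ge0 // mulr_ge0 //.
exact: bigmax_ge_id.
Qed.

Theorem theorem2 (R : realType) (n m q o N : nat)
  (A : 'M[R]_n) (B : 'M[R]_(n, m)) (C : 'M[R]_(q, n))
  (x : int -> 'cV[R]_n) (u : int -> 'cV[R]_m) (z d y : int -> 'cV[R]_q)
  (dbar0 dbar : 'I_q -> R) (i : 'I_q)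
  (Omega : forall p : nat, set (param R o m p))
  (lambda : nat -> R) (alpha gamma delta : R)
  (pbar_i : nat) (L' L rho : R)
  (pbar : nat) (theta1 : param R o m 1)
  (o_gt0 : (0 < o)%N)
  (data : trajectory o A B C x u z d y dbar0)
  (dbar_gt0 : 0 < dbar i)
  (Omega_compact : forall p, (1 <= p)%N -> compact (Omega p))
  (lambdaP : forall p, (1 <= p)%N ->
     is_lambda N (fun k => y k i 0) u (dbar i) (Omega p) (lambda p))
  (alpha_gt1 : 1 < alpha) (gamma_gt1 : 1 < gamma)
  (pbar_iP : is_decay_horizon lambda delta pbar_i)
  (decay_fit : is_decay_fit lambda pbar_i L' rho)
  (LE : L = L' / (o%:R * dbar i))
  (pbar_gt0 : (0 < pbar)%N)
  (theta1_Gamma : forall p, (2 <= p <= pbar)%N ->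
     Gamma L rho (h p theta1)) :
  let chi := o%:R * L * rho ^+ pbar.+1 in
  let tau1 := fun p : nat =>
    tau_direct N (fun k => y k i 0) u gamma (alpha * lambda p) (dbar i) L rho
      (h p theta1) in
  (tau o pbar tau1 (dbar i) chi p @[p --> \oo]
     --> tau_infty (tau1 pbar) (dbar i) chi) <->
  o%:R * L * rho ^+ pbar.+1 < 1.
Proof.
move=> chi tau1.
have [[L'0 rho0 _ _] _] := decay_fit.
have chi0 : 0 < chi.
  by rewrite /chi LE !mulr_gt0 ?invr_gt0 ?mulr_gt0 ?exprn_gt0 ?ltr0n.
have tau1_ge0 p : (1 <= p <= pbar)%N -> 0 <= tau1 p.
  case/andP=> p1 _; have [[lam0 _] _] := lambdaP _ p1.
  apply: tau_direct_ge0; first exact: ltW (lt_trans ltr01 gamma_gt1).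
  by rewrite mulr_ge0 // ltW // (lt_trans ltr01).
split; first exact: tau_cvg_lt1 pbar_gt0 tau1_ge0 _ dbar_gt0.
exact: tau_cvg pbar_gt0 tau1_ge0 (ltW chi0).
Qed.
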